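(* Let $G$ be a countably infinite (discrete) group, let $D\subseteq G$ be nice vdC, and suppose that $D=D_1\cup\cdots\cup D_m$ (with $m\geq 1$). Then at least one of the sets $D_1,\dots,D_m$ is nice vdC.
   Context: A measure-preserving system (m.p.s.) $(X,\mathscr{B},\mu,(T_g)_{g\in G})$ consists of a standard probability space $(X,\mathscr{B},\mu)$ and a measure-preserving action $T$ of $G$ on it. A set $R\subseteq G$ is nice vdC if for every m.p.s. $(X,\mathscr{B},\mu,(T_g)_{g\in G})$, every complex-valued $f\in L^\infty(X,\mu)$, and every $\varepsilon>0$, there is $r\in R$ such that $\left|\int_X f(T_{r^{-1}}x)\overline{f(x)}\,d\mu(x)\right|\geq\left|\int_X f\,d\mu\right|^2-\varepsilon$. *)

(* Defs.v *)
From HB Require Import structures.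
From mathcomp Require Import all_boot all_order all_algebra complex.
From mathcomp Require Import all_classical all_reals all_analysis.

Set Implicit Arguments.
Unset Strict Implicit.
Unset Printing Implicit Defensive.

Import Order.TTheory GRing.Theory Num.Theory.

Local Open Scope classical_set_scope.
Local Open Scope ring_scope.

(* A Polish space is rendered as a separable Hausdorff complete pseudometric
   space Y. The map h transports its topology to X, whose measurable sets have
   to be exactly the corresponding Borel sets. *)
Definition standard_borel (R : realType) (d : measure_display)
    (X : measurableType d) : Prop :=
  exists (Y : completePseudoMetricType R) (h : X -> Y),
    [/\ hausdorff_space Y,
        exists2 S : set Y, countable S & dense S,
        bijective h &
        forall A : set X, measurable A <-> <<s @open Y >> (h @` A)].

Definition measure_preserving (R : realType) (d : measure_display)
    (X : measurableType d) (mu : probability X R) (f : X -> X) : Prop :=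
  measurable_fun [set: X] f /\
  forall A : set X, measurable A -> mu (f @^-1` A) = mu A.

Definition measure_preserving_action (G : groupType) (R : realType)
    (d : measure_display) (X : measurableType d) (mu : probability X R)
    (T : G -> X -> X) : Prop :=
  [/\ forall x, T 1%g x = x,
      forall g h x, T (g * h)%g x = T g (T h x) &
      forall g, measure_preserving mu (T g)].

(* R[i] carries no measurable structure: measurability and integration of
   complex-valued functions are defined through real and imaginary parts. *)
Definition cmeasurable (R : realType) (d : measure_display)
    (X : measurableType d) (f : X -> R[i]) : Prop :=
  measurable_fun [set: X] (fun x => complex.Re (f x)) /\
  measurable_fun [set: X] (fun x => complex.Im (f x)).

Definition cintegral (R : realType) (d : measure_display)
    (X : measurableType d) (mu : probability X R) (f : X -> R[i]) : R[i] :=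
  Complex (\int[mu]_x complex.Re (f x)) (\int[mu]_x complex.Im (f x)).

Definition Linfty (R : realType) (d : measure_display)
    (X : measurableType d) (mu : probability X R) (f : X -> R[i]) : Prop :=
  cmeasurable f /\ finite_norm mu +oo%E (fun x => complex.Re `|f x|).

Definition nice_vdC (R : realType) (G : groupType) (D : set G) : Prop :=
  forall (d : measure_display) (X : measurableType d) (mu : probability X R)
    (T : G -> X -> X),
    standard_borel R X -> measure_preserving_action mu T ->
  forall f : X -> R[i], Linfty mu f ->
  forall e : R, 0 < e ->
  exists2 r : G, D r &
    `|cintegral mu f| ^+ 2 - (e%:C)%C
      <= `|cintegral mu (fun x => f (T (r^-1)%g x) * (f x)^*)|.

(* Main.v *)
(* Call D negative if some positive-definite function phi on G, namely the
   correlation g |-> \int f(T_{g^-1} x) f(x) of a bounded real f with zero mean,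
   satisfies phi <= - e < 0 on D. D is nice vdC iff it is not negative: adding a
   large constant to f turns phi <= - e into a failure of the nice vdC inequality;
   conversely, from a failure, centre the real and imaginary parts of f and add
   their correlations. Direct sums and products of independent copies make the
   correlations phi closed under sums and products. If phi is negative on D then
   (1 + t phi) ^ n - 1 is close to -1 on D for suitable t and n. Given x close to
   -1 on D and y close to -1 on E, the polynomial
   p(x, y) = x + y + 2 x y + x^2 y + x y^2, which has nonnegative coefficients and
   no constant term, satisfies p(-1, y) = p(y, -1) = -1 - y^2, so it is negative
   on the union of D and E. *)
From HB Require Import structures.
Require Import Defs.
From mathcomp Require Import all_boot all_order all_algebra complex.
From mathcomp Require Import all_classical all_reals all_analysis.
From mathcomp Require Import measurable_realfun ess_sup_inf.
From mathcomp Require Import ring lra.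

Set Implicit Arguments.
Unset Strict Implicit.
Unset Printing Implicit Defensive.

Import Order.TTheory GRing.Theory Num.Theory.

Local Open Scope classical_set_scope.
Local Open Scope ring_scope.

(** * Products of standard Borel spaces *)

HB.instance Definition _ (R : realType) (U V : completePseudoMetricType R) :=
  isPointed.Build (U * V)%type (point, point).

(** Both coordinate pushforwards of [F] are Cauchy, hence converge, and a basic neighbourhood of the
    pair of limits contains the intersection of two cylinders belonging to [F]. This makes [U * V]
    complete, so that it can serve as the Polish model of a product. *)
Lemma prod_cauchy_cvg (R : realType) (U V : completePseudoMetricType R)
    (F : set_system (U * V)) (FF : ProperFilter F) : cauchy F -> cvg F.
Proof.
move=> /cauchyP cF.
have cU : cauchy (fst @ F).
  apply/cauchyP => e e0; have [z Fz] := cF e e0; exists z.1.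
  change (F (fst @^-1` ball z.1 e)).
  by apply: (filterS _ (Fz : F _)) => y [].
have cV : cauchy (snd @ F).
  apply/cauchyP => e e0; have [z Fz] := cF e e0; exists z.2.
  change (F (snd @^-1` ball z.2 e)).
  by apply: (filterS _ (Fz : F _)) => y [].
have {}cU := cauchy_cvg (fst @ F) cU.
have {}cV := cauchy_cvg (snd @ F) cV.
apply/cvg_ex; exists (lim (fst @ F), lim (snd @ F)).
move=> A [[P Q] [/= nP nQ] PQA].
have FP : F (fst @^-1` P) by exact: cU nP.
have FQ : F (snd @^-1` Q) by exact: cV nQ.
by apply: filterS (filterI FP FQ) => -[x y] [/= Px Qy]; exact: PQA.
Qed.

HB.instance Definition _ (R : realType) (U V : completePseudoMetricType R) :=
  Uniform_isComplete.Build (U * V)%type (@prod_cauchy_cvg R U V).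

Lemma hausdorff_prod (U V : topologicalType) :
  hausdorff_space U -> hausdorff_space V -> hausdorff_space (U * V)%type.
Proof.
move=> hU hV [p p'] [q q'] cl; congr pair; [apply: hU|apply: hV] => A B nA nB.
- have [||[x y] [/= Ax Bx]] := cl (fst @^-1` A) (fst @^-1` B); last by exists x.
  + by apply: (@cvg_fst _ _ (nbhs p) (nbhs p')).
  + by apply: (@cvg_fst _ _ (nbhs q) (nbhs q')).
- have [||[x y] [/= Ax Bx]] := cl (snd @^-1` A) (snd @^-1` B); last by exists y.
  + by apply: (@cvg_snd _ _ (nbhs p) (nbhs p')).
  + by apply: (@cvg_snd _ _ (nbhs q) (nbhs q')).
Qed.

Lemma dense_nbhs (T : topologicalType) (S : set T) (x : T) (A : set T) :
  dense S -> nbhs x A -> exists2 s, S s & A s.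
Proof.
move=> dS nA; have [||s [As Ss]] := dS A°; last by exists s => //; exact: interior_subset.
- by exists x.
- exact: open_interior.
Qed.

Lemma dense_setX (U V : topologicalType) (S : set U) (S' : set V) :
  dense S -> dense S' -> dense (S `*` S').
Proof.
move=> dS dS' O [[x y] Oxy] oO.
have [[P Q] [/= nP nQ] PQO] : nbhs (x, y) O by exact: open_nbhs_nbhs.
have [s Ss Ps] := dense_nbhs dS nP; have [s' Ss' Qs'] := dense_nbhs dS' nQ.
by exists (s, s'); split => //; exact: PQO.
Qed.

(** Centres range over dense sets and radii over the $1/(n+1)$, so for countable [S] and [S'] the
    union is countable; this is how an open set of the product is reached from open boxes. Interiors
    are taken because a ball of a pseudometric space need not be open here. *)
Lemma open_prod_bigcup (R : realType) (U V : pseudoMetricType R)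
    (S : set U) (S' : set V) (O : set (U * V)) :
  dense S -> dense S' -> open O ->
  O = \bigcup_(i in [set i : U * V * nat | (S `*` S') i.1 /\
        (ball i.1.1 i.2.+1%:R^-1)° `*` (ball i.1.2 i.2.+1%:R^-1)° `<=` O])
      ((ball i.1.1 (i.2.+1%:R^-1 : R))° `*` (ball i.1.2 i.2.+1%:R^-1)°).
Proof.
move=> dS dS' oO; apply/seteqP; split=> [[x y] Oxy|p [i [_ iO] ip]]; last exact: iO.
have /nbhs_ballP[e /= e0 eO] : nbhs (x, y) O by exact: open_nbhs_nbhs.
have [n ne] : exists n, n.+1%:R^-1 < e / 2 :> R.
  have [n _ /(_ n (leqnn n))] := near_infty_natSinv_lt (PosNum (divr_gt0 e0 (ltr0Sn R 1))).
  by exists n.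
(* A centre within [d] of a point leaves that point interior to the ball of radius $2d = 1/(n+1)$,
   and $3d < e$ keeps this ball inside the ball of radius [e] around the point. *)
pose d : R := n.+1%:R^-1 / 2.
have d0 : 0 < d by rewrite divr_gt0// invr_gt0.
have dd : d + d = n.+1%:R^-1 by rewrite /d -splitr.
have key (W : pseudoMetricType R) (z s : W) : ball z d s ->
    (ball s n.+1%:R^-1)° z /\ ball s n.+1%:R^-1 `<=` ball z e.
  move=> zs; split.
    apply/nbhs_ballP; exists d => //= w zw; rewrite -dd.
    exact: ball_triangle (ball_sym zs) zw.
  move=> w sw; apply: (@le_ball _ _ _ (d + n.+1%:R^-1)).
    by rewrite -dd in ne *; lra.
  exact: ball_triangle zs sw.
have [s Ss xs] := dense_nbhs dS (nbhsx_ballx x d d0).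
have [s' Ss' ys'] := dense_nbhs dS' (nbhsx_ballx y d d0).
have [xi xb] := key _ _ _ xs; have [yi yb] := key _ _ _ ys'.
exists (s, s', n) => //=; split=> // -[w w'] [/= /interior_subset/xb ww /interior_subset/yb ww'].
by apply: eO; split.
Qed.

Lemma countable_bigcup_measurable d (T : measurableType d) (I : pointedType)
    (D : set I) (F : I -> set T) : countable D ->
  (forall i, D i -> measurable (F i)) -> measurable (\bigcup_(i in D) F i).
Proof.
move=> /countable_injP[f injf] mF.
rewrite -(injpinv_image (fun=> point) injf) bigcup_image.
apply: bigcup_measurable => _ [i Di <-].
by rewrite pinvKV ?inE//; exact: mF.
Qed.

(** The product map [H] has inverse [K], and the two directions of the Borel condition are the
    measurability of [K] and of [H]. *)
Lemma standard_borel_prod (R : realType) (d d' : measure_display)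
    (X : measurableType d) (X' : measurableType d') :
  standard_borel R X -> standard_borel R X' -> standard_borel R (X * X')%type.
Proof.
move=> [Y [h [hY [S cS dS] [k hk kh] mh]]] [Y' [h' [hY' [S' cS' dS'] [k' hk' kh'] mh']]].
pose H (x : X * X') := (h x.1, h' x.2); pose K (y : Y * Y') := (k y.1, k' y.2).
have HK : cancel H K by move=> [x x']; rewrite /H /K /= hk hk'.
have KH : cancel K H by move=> [y y']; rewrite /H /K /= kh kh'.
have imE (T T' : Type) (f : T -> T') g A : cancel f g -> cancel g f -> f @` A = g @^-1` A.
  move=> fg gf; apply/seteqP; split=> [_ [x Ax <-]|y Ay] /=; first by rewrite fg.
  by exists (g y).
have preK (T T' : Type) (f : T -> T') g B : cancel f g -> f @^-1` (g @^-1` B) = B.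
  by move=> fg; apply/funext => x /=; rewrite /preimage /= fg.
exists (Y * Y')%type, H; split.
- exact: hausdorff_prod.
- by exists (S `*` S'); [exact: countableX|exact: dense_setX].
- by exists K.
pose BB := g_sigma_algebraType (@open (Y * Y')%type).
(* Each coordinate of [K] is a continuous projection followed by a Borel isomorphism. *)
have mK : measurable_fun [set: BB] (K : BB -> X * X').
  apply: measurable_fun_pair => _ A mA; rewrite setTI.
  - have := proj1 (mh A) mA; rewrite (imE _ _ _ _ _ hk kh) => kA.
    have mf : measurable_fun [set: BB] (fst : BB -> g_sigma_algebraType (@open Y)).
      apply: (@measurability _ _ BB (g_sigma_algebraType (@open Y)) setT fst (@open Y)) =>
    // _ [W oW <-]; rewrite setTI.
      apply: sub_sigma_algebra; apply: open_comp => // -[x y] _.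
      exact: cvg_fst.
    by have := mf measurableT _ kA; rewrite setTI.
  - have := proj1 (mh' A) mA; rewrite (imE _ _ _ _ _ hk' kh') => kA.
    have mf : measurable_fun [set: BB] (snd : BB -> g_sigma_algebraType (@open Y')).
      apply: (@measurability _ _ BB (g_sigma_algebraType (@open Y')) setT snd (@open Y')) =>
    // _ [W oW <-]; rewrite setTI.
      apply: sub_sigma_algebra; apply: open_comp => // -[x y] _.
      exact: cvg_snd.
    by have := mf measurableT _ kA; rewrite setTI.
have mo (O : set Y) : open O -> measurable (h @^-1` O).
  move=> oO; apply/mh; rewrite (imE _ _ _ _ _ hk kh) preK//.
  exact: sub_sigma_algebra.
have mo' (O : set Y') : open O -> measurable (h' @^-1` O).
  move=> oO; apply/mh'; rewrite (imE _ _ _ _ _ hk' kh') preK//.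
  exact: sub_sigma_algebra.
(* Separability enters here: an open set is a countable union of open boxes, whose preimages are
   measurable rectangles. *)
have mH : measurable_fun [set: X * X'] (H : X * X' -> BB).
  apply: (@measurability _ _ _ BB setT H (@open (Y * Y')%type)) =>
    // _ [W oW <-]; rewrite setTI.
  rewrite [W](open_prod_bigcup dS dS' oW) preimage_bigcup.
  set I := [set _ | _].
  have cI : countable I.
    apply: (@sub_countable _ _ _ ((S `*` S') `*` [set: nat])); last by do 2?apply: countableX.
    by apply: subset_card_le => -[[s s'] n] [? ?]; split.
  apply: countable_bigcup_measurable => // i _.
  have -> (P : set Y) (Q : set Y') : H @^-1` (P `*` Q) = (h @^-1` P) `*` (h' @^-1` Q) by [].
  by apply: measurableX; [apply: mo|apply: mo']; exact: open_interior.
move=> A; rewrite (imE _ _ _ _ _ HK KH); split => [mA|mA].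
- by have := mK measurableT _ mA; rewrite setTI.
- by have := mH measurableT _ mA; rewrite setTI preK.
Qed.

(** * Bounded measurable real functions and their integrals *)

Definition bounded_measurable (R : realType) d (X : measurableType d) (f : X -> R) :=
  measurable_fun [set: X] f /\ exists M, forall x, `|f x| <= M.

Section bounded_measurable.
Context (R : realType) d (X : measurableType d).
Implicit Types (f g : X -> R) (mu : probability X R).

Lemma bounded_measurable_cst (c : R) : bounded_measurable (fun _ : X => c).
Proof. by split; [exact: measurable_cst|exists `|c|]. Qed.

Lemma bounded_measurableD f g : bounded_measurable f -> bounded_measurable g ->
  bounded_measurable (fun x => f x + g x).
Proof.
move=> [mf [M fM]] [mg [N gN]]; split; first exact: measurable_funD.
by exists (M + N) => x; rewrite (le_trans (ler_normD _ _))// lerD.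
Qed.

Lemma bounded_measurableM f g : bounded_measurable f -> bounded_measurable g ->
  bounded_measurable (fun x => f x * g x).
Proof.
move=> [mf [M fM]] [mg [N gN]]; split; first exact: measurable_funM.
by exists (M * N) => x; rewrite normrM ler_pM.
Qed.

Lemma bounded_measurable_comp d' (Y : measurableType d') (phi : Y -> X) f :
  measurable_fun [set: Y] phi -> bounded_measurable f ->
  bounded_measurable (fun y => f (phi y)).
Proof.
move=> mphi [mf [M fM]]; split; first exact: measurableT_comp.
by exists M.
Qed.

Lemma bounded_measurable_integrable mu f :
  bounded_measurable f -> mu.-integrable setT (EFin \o f).
Proof.
move=> [mf [M fM]]; apply: measurable_bounded_integrable => //.
  by apply: le_lt_trans (probability_le1 mu measurableT) _; rewrite ltry.
exists M; split; first exact: num_real.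
by move=> N MN x _ /=; rewrite (le_trans (fM x))// ltW.
Qed.

Lemma probability_RintegralD mu f g : bounded_measurable f -> bounded_measurable g ->
  \int[mu]_x (f x + g x) = \int[mu]_x f x + \int[mu]_x g x.
Proof. by move=> bf bg; rewrite RintegralD//; exact: bounded_measurable_integrable. Qed.

Lemma probability_RintegralZ mu (c : R) f : bounded_measurable f ->
  \int[mu]_x (c * f x) = c * \int[mu]_x f x.
Proof. by move=> bf; rewrite RintegralZl//; exact: bounded_measurable_integrable. Qed.

Lemma probability_Rintegral_cst mu (c : R) : \int[mu]_x c = c.
Proof.
rewrite Rintegral_cst// -[RHS]mulr1; congr (_ * _).
exact: (congr1 fine (probability_setT mu)).
Qed.

Lemma Rintegral_comp_preserving mu (phi : X -> X) f :
  measure_preserving mu phi -> bounded_measurable f ->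
  \int[mu]_x f (phi x) = \int[mu]_x f x.
Proof.
move=> [mphi phimu] bf; have [mf _] := bf; congr fine.
have := @integral_pushforward _ _ X X R phi mphi mu setT (EFin \o f).
rewrite preimage_setT => <-//.
- by apply: eq_measure_integral => /= A mA _; exact: phimu.
- exact/measurable_EFinP.
- apply: (bounded_measurable_integrable mu (f := f \o phi)).
  exact: bounded_measurable_comp.
Qed.

End bounded_measurable.

(** * Products of measure-preserving systems *)

Section product_system.
Context (R : realType) d d' (X : measurableType d) (Y : measurableType d').
Variables (mu : probability X R) (nu : probability Y R).

Definition product_probability : probability (X * Y)%type R := (mu \x nu)%E.

Lemma Rintegral_prodM (f : X -> R) (g : Y -> R) :
  bounded_measurable f -> bounded_measurable g ->
  \int[product_probability]_z (f z.1 * g z.2) = (\int[mu]_x f x) * (\int[nu]_y g y).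
Proof.
move=> bf bg.
have bfg : bounded_measurable (fun z : X * Y => f z.1 * g z.2).
  apply: bounded_measurableM.
  - exact: (bounded_measurable_comp (@measurable_fst _ _ X Y)).
  - exact: (bounded_measurable_comp (@measurable_snd _ _ X Y)).
rewrite {1}/Rintegral /product_probability -integral12_prod_meas1; last first.
  exact: (bounded_measurable_integrable _ bfg).
have -> : fubini_F nu (fun z : X * Y => (f z.1 * g z.2)%:E) =
    (fun x => ((\int[nu]_y g y) * f x)%:E).
  apply/funext => x; rewrite /fubini_F /= [X in X%:E]mulrC -probability_RintegralZ//.
  rewrite /Rintegral fineK//; apply: integrable_fin_num => //.
  apply: (bounded_measurable_integrable nu (f := fun y => f x * g y)).
  by apply: bounded_measurableM => //; exact: bounded_measurable_cst.
by rewrite -[LHS]/(\int[mu]_x _) probability_RintegralZ// mulrC.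
Qed.

(** The pushforward of the product measure agrees with the product measure on rectangles, and a
    product measure is determined by its values there. *)
Lemma measure_preserving_prod (T : X -> X) (S : Y -> Y) :
  measure_preserving mu T -> measure_preserving nu S ->
  measure_preserving product_probability (fun z : X * Y => (T z.1, S z.2)).
Proof.
move=> [mT muT] [mS nuS].
have mTS : measurable_fun [set: X * Y] (fun z : X * Y => (T z.1, S z.2)).
  by apply: measurable_fun_pair; apply: measurableT_comp.
split=> // A mA.
pose m' : {measure set (X * Y) -> \bar R} :=
  pushforward product_probability (fun z : X * Y => (T z.1, S z.2)).
rewrite -[LHS]/(m' mTS A); symmetry.
suff m'E B C : measurable B -> measurable C -> m' mTS (B `*` C) = (mu B * nu C)%E.
  exact: (product_measure_unique m'E mA).
move=> mB mC.
transitivity ((mu \x nu)%E ((T @^-1` B) `*` (S @^-1` C))); first by [].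
rewrite product_measure1E//; first by congr (_ * _)%E; [exact: muT|exact: nuS].
- by rewrite -[X in measurable X]setTI; exact: mT.
- by rewrite -[X in measurable X]setTI; exact: mS.
Qed.

Lemma measure_preserving_action_prod (G : groupType) (T : G -> X -> X) (S : G -> Y -> Y) :
  measure_preserving_action mu T -> measure_preserving_action nu S ->
  measure_preserving_action product_probability (fun g (z : X * Y) => (T g z.1, S g z.2)).
Proof.
move=> [T1 TM Tmu] [S1 SM Snu]; split.
- by move=> [x y] /=; rewrite T1 S1.
- by move=> g h [x y] /=; rewrite TM SM.
- by move=> g; exact: measure_preserving_prod.
Qed.

End product_system.

(** * Zero-mean correlations and their closure properties *)

(** The system is quantified inside, so that correlations coming from different systems can be
    combined. Taking [f] real and bounded everywhere keeps complex numbers and null sets out of the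
    closure properties. *)
Definition zero_mean_correlation (R : realType) (G : groupType) (phi : G -> R) : Prop :=
  exists (d : measure_display) (X : measurableType d) (mu : probability X R)
    (T : G -> X -> X) (f : X -> R),
    [/\ standard_borel R X, measure_preserving_action mu T, bounded_measurable f,
        \int[mu]_x f x = 0 &
        forall g, \int[mu]_x (f (T g^-1%g x) * f x) = phi g].

Section zero_mean_correlation.
Context (R : realType) (G : groupType).
Implicit Types phi psi : G -> R.

(** On the product system take $f(x) + h(y)$. By Fubini each cross term of its correlation is a
    product of means, hence zero. *)
Lemma zero_mean_correlationD phi psi :
  zero_mean_correlation phi -> zero_mean_correlation psi ->
  zero_mean_correlation (fun g => phi g + psi g).
Proof.
move=> [d [X [mu [T [f [sX aT bf f0 fphi]]]]]].
move=> [d' [Y [nu [S [h [sY aS bh h0 hpsi]]]]]].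
have [_ _ mT] := aT; have [_ _ mS] := aS.
pose P := product_probability mu nu.
have b1 d0 (Z : measurableType d0) : bounded_measurable (fun _ : Z => 1 : R).
  exact: bounded_measurable_cst.
have bX (k : X -> R) : bounded_measurable k -> bounded_measurable (fun z : X * Y => k z.1).
  exact: bounded_measurable_comp (@measurable_fst _ _ X Y).
have bY (k : Y -> R) : bounded_measurable k -> bounded_measurable (fun z : X * Y => k z.2).
  exact: bounded_measurable_comp (@measurable_snd _ _ X Y).
have IX (k : X -> R) : bounded_measurable k -> \int[P]_z k z.1 = \int[mu]_x k x.
  move=> bk; have := Rintegral_prodM mu nu bk (b1 _ Y).
  by rewrite probability_Rintegral_cst mulr1 => <-; apply: eq_Rintegral => z _; rewrite mulr1.
have IY (k : Y -> R) : bounded_measurable k -> \int[P]_z k z.2 = \int[nu]_x k x.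
  move=> bk; have := Rintegral_prodM mu nu (b1 _ X) bk.
  by rewrite probability_Rintegral_cst mul1r => <-; apply: eq_Rintegral => z _; rewrite mul1r.
exists _, (X * Y)%type, P, (fun g z => (T g z.1, S g z.2)), (fun z => f z.1 + h z.2).
split.
- exact: standard_borel_prod.
- exact: measure_preserving_action_prod.
- exact: bounded_measurableD (bX _ bf) (bY _ bh).
- by rewrite (probability_RintegralD P (bX _ bf) (bY _ bh)) IX// IY// f0 h0 addr0.
move=> g /=.
have bfT : bounded_measurable (fun x => f (T g^-1%g x)).
  exact: bounded_measurable_comp (proj1 (mT g^-1%g)) bf.
have bhS : bounded_measurable (fun y => h (S g^-1%g y)).
  exact: bounded_measurable_comp (proj1 (mS g^-1%g)) bh.
have bff := bounded_measurableM bfT bf.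
have bhh := bounded_measurableM bhS bh.
transitivity (\int[P]_z ((f (T g^-1%g z.1) * f z.1 + h (S g^-1%g z.2) * h z.2)
    + (f (T g^-1%g z.1) * h z.2 + f z.1 * h (S g^-1%g z.2)))).
  by apply: eq_Rintegral => z _; ring.
have bMXY (k : X -> R) (l : Y -> R) : bounded_measurable k -> bounded_measurable l ->
    bounded_measurable (fun z : X * Y => k z.1 * l z.2).
  by move=> bk bl; exact: bounded_measurableM (bX _ bk) (bY _ bl).
rewrite (probability_RintegralD P (bounded_measurableD (bX _ bff) (bY _ bhh))
  (bounded_measurableD (bMXY _ _ bfT bh) (bMXY _ _ bf bhS))).
rewrite (probability_RintegralD P (bX _ bff) (bY _ bhh)).
rewrite (probability_RintegralD P (bMXY _ _ bfT bh) (bMXY _ _ bf bhS)).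
rewrite (IX _ bff) (IY _ bhh) fphi hpsi.
rewrite (Rintegral_prodM mu nu bfT bh) (Rintegral_prodM mu nu bf bhS).
by rewrite f0 h0 mulr0 mul0r !addr0.
Qed.

(** On the product system take $f(x) h(y)$; its mean and its correlation both factor. *)
Lemma zero_mean_correlationM phi psi :
  zero_mean_correlation phi -> zero_mean_correlation psi ->
  zero_mean_correlation (fun g => phi g * psi g).
Proof.
move=> [d [X [mu [T [f [sX aT bf f0 fphi]]]]]].
move=> [d' [Y [nu [S [h [sY aS bh h0 hpsi]]]]]].
have [_ _ mT] := aT; have [_ _ mS] := aS.
exists _, (X * Y)%type, (product_probability mu nu), (fun g z => (T g z.1, S g z.2)),
  (fun z => f z.1 * h z.2).
split.
- exact: standard_borel_prod.
- exact: measure_preserving_action_prod.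
- exact: bounded_measurableM (bounded_measurable_comp (@measurable_fst _ _ X Y) bf)
    (bounded_measurable_comp (@measurable_snd _ _ X Y) bh).
- by rewrite Rintegral_prodM// f0 mul0r.
move=> g /=; rewrite -fphi -hpsi -Rintegral_prodM; last 2 first.
- exact: bounded_measurableM (bounded_measurable_comp (proj1 (mT g^-1%g)) bf) bf.
- exact: bounded_measurableM (bounded_measurable_comp (proj1 (mS g^-1%g)) bh) bh.
by apply: eq_Rintegral => z _; ring.
Qed.

Lemma zero_mean_correlationZ (c : R) phi : 0 <= c ->
  zero_mean_correlation phi -> zero_mean_correlation (fun g => c * phi g).
Proof.
move=> c0 [d [X [mu [T [f [sX aT bf f0 fphi]]]]]]; have [_ _ mT] := aT.
exists d, X, mu, T, (fun x => Num.sqrt c * f x); split => //.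
- by apply: bounded_measurableM => //; exact: bounded_measurable_cst.
- by rewrite probability_RintegralZ// f0 mulr0.
move=> g; rewrite -fphi -probability_RintegralZ; last first.
  exact: bounded_measurableM (bounded_measurable_comp (proj1 (mT g^-1%g)) bf) bf.
by apply: eq_Rintegral => x _; rewrite -[X in X * (_ * _)](sqr_sqrtr c0); ring.
Qed.

Lemma zero_mean_correlation_bounded phi : zero_mean_correlation phi ->
  exists M : R, forall g, `|phi g| <= M.
Proof.
move=> [d [X [mu [T [f [sX aT bf f0 fphi]]]]]]; have [_ _ mT] := aT.
have [_ [M fM]] := bf; exists (M * M) => g.
have bff : bounded_measurable (fun x => f (T g^-1%g x) * f x).
  exact: bounded_measurableM (bounded_measurable_comp (proj1 (mT g^-1%g)) bf) bf.
have ffM x : `|f (T g^-1%g x) * f x| <= M * M by rewrite normrM ler_pM.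
rewrite -fphi -[leRHS](probability_Rintegral_cst mu).
apply: le_trans (le_normr_Rintegral _ (bounded_measurable_integrable mu bff)) _ => //.
apply: le_Rintegral => //; apply: bounded_measurable_integrable.
- have [mff _] := bff; split; first exact: measurableT_comp.
  by exists (M * M) => x; rewrite normr_id.
- exact: bounded_measurable_cst.
Qed.

End zero_mean_correlation.

(** * Negative sets: amplification and finite unions *)

Definition negative_correlation (R : realType) (G : groupType) (D : set G) : Prop :=
  exists2 phi : G -> R, zero_mean_correlation phi &
    exists2 e : R, 0 < e & forall g, D g -> phi g <= - e.

Section negative_correlation.
Context (R : realType) (G : groupType).
Implicit Types D E : set G.

Lemma eq_zero_mean_correlation (phi psi : G -> R) : phi =1 psi ->
  zero_mean_correlation phi -> zero_mean_correlation psi.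
Proof. by move=> /funext ->. Qed.

(** With $\psi_n = (1 + \varphi)^{n+1} - 1$ one has $\psi_{n+1} = \psi_n + \varphi + \psi_n
    \varphi$, which uses only sums and products. *)
Lemma zero_mean_correlation_onem_expr (phi : G -> R) (n : nat) :
  zero_mean_correlation phi ->
  zero_mean_correlation (fun g => (1 + phi g) ^+ n.+1 - 1).
Proof.
move=> cphi; elim: n => [|n IH].
  by apply: eq_zero_mean_correlation cphi => g; ring.
apply: eq_zero_mean_correlation
  (zero_mean_correlationD IH (zero_mean_correlationD cphi (zero_mean_correlationM IH cphi))) => g.
by rewrite [in RHS]exprS; ring.
Qed.

Lemma negative_correlation_amplify D : negative_correlation R D ->
  exists2 phi : G -> R, zero_mean_correlation phi &
    forall g, D g -> -1 <= phi g <= - (3 / 4).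
Proof.
move=> [phi cphi [e e0 phie]]; have [M phiM] := zero_mean_correlation_bounded cphi.
(* Since $|\varphi| \le K$, on [D] the values of $1 + \varphi / K$ lie in $[0, q]$ with $q = 1 -
   e/K$. The summand [e] in [K] gives both $K > 0$ and $q \ge 0$. *)
pose K := `|M| + e; have K0 : 0 < K by rewrite ltr_wpDl.
pose q := 1 - K^-1 * e.
have q0 : 0 <= q by rewrite subr_ge0 ler_pdivrMl// mulr1 lerDr.
have q1 : q < 1 by rewrite ltrBlDr ltrDl mulr_gt0// invr_gt0.
have [n qn] : exists n, q ^+ n.+1 <= 1 / 4.
  have /cvgrPdist_le/(_ (1 / 4)) : q ^+ n @[n --> \oo] --> 0.
    by apply: cvg_expr; rewrite ger0_norm.
  move=> /(_ ltac:(lra))[n _ /(_ n.+1 (leqnSn n))] /=.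
  by rewrite sub0r normrN ger0_norm ?exprn_ge0// => ?; exists n.
exists (fun g => (1 + K^-1 * phi g) ^+ n.+1 - 1).
  apply: zero_mean_correlation_onem_expr; apply: zero_mean_correlationZ => //.
  by rewrite invr_ge0 ltW.
move=> g Dg; have phiK : - K <= phi g.
  have := ler_norm (- phi g); have := phiM g; have := ler_norm M.
  by rewrite normrN /K; lra.
have l0 : 0 <= 1 + K^-1 * phi g by rewrite -lerBlDl sub0r ler_pdivlMl// mulrN1.
have lq : 1 + K^-1 * phi g <= q.
  by rewrite lerD2l -mulrN ler_pM2l ?invr_gt0//; exact: phie.
have := exprn_ge0 n.+1 l0; have := lerXn2r n.+1 l0 q0 lq.
by move=> ? ?; apply/andP; split; lra.
Qed.

Lemma negative_correlationU D E : negative_correlation R D -> negative_correlation R E ->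
  negative_correlation R (D `|` E).
Proof.
move=> /negative_correlation_amplify[x cx xD] /negative_correlation_amplify[y cy yE].
pose p (s t : R) := s + t + 2 * (s * t) + s * s * t + s * t * t.
exists (fun g => p (x g) (y g)).
  have cxy := zero_mean_correlationM cx cy.
  apply: zero_mean_correlationD; last exact: zero_mean_correlationM.
  apply: zero_mean_correlationD.
    apply: zero_mean_correlationD; first exact: zero_mean_correlationD.
    exact: zero_mean_correlationZ.
  by apply: zero_mean_correlationM => //; exact: zero_mean_correlationM.
have pC s t : p s t = p t s by rewrite /p; ring.
(* [p (-1) t = -1 - t ^ 2], which persists for [s] close to [-1]. *)
have pneg s t : -1 <= s <= - (3 / 4) -> p s t <= - (1 / 2).
  move=> /andP[s0 s1]; pose u := 1 + s.
  have u0 : 0 <= u by rewrite /u; lra.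
  have u1 : u <= 1 / 4 by rewrite /u; lra.
  (* Here [t] is arbitrary, so the error terms are measured against $1 + t^2$: each is at most a
     quarter of it, the last one because $2t \le 1 + t^2$. Hence $p(s, t) \le -(1 + t^2)/2$. *)
  have -> : p s t = - (1 + t ^+ 2) + u * (1 + t ^+ 2) + u ^+ 2 * t by rewrite /p /u; ring.
  have t2 := sqr_ge0 t; have t3 := sqr_ge0 (1 - t).
  have : u * (1 + t ^+ 2) <= 1 / 4 * (1 + t ^+ 2) by rewrite ler_wpM2r// addr_ge0.
  have : u ^+ 2 * t <= 1 / 4 * (1 + t ^+ 2).
    apply: (@le_trans _ _ (u ^+ 2 * ((1 + t ^+ 2) / 2))).
      by rewrite ler_wpM2l ?sqr_ge0//; nra.
    have : u ^+ 2 <= 1 / 4 by nra.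
    by nra.
  by nra.
exists (1 / 2); first by lra.
by move=> g [Dg|Eg]; [exact: pneg (xD _ Dg)|rewrite pC; exact: pneg (yE _ Eg)].
Qed.

Lemma negative_correlation_sub D E : D `<=` E ->
  negative_correlation R E -> negative_correlation R D.
Proof.
move=> DE [phi cphi [e e0 phie]]; exists phi => //; exists e => // g /DE; exact: phie.
Qed.

Lemma negative_correlation_bigcup (m : nat) (D : 'I_m -> set G) : (0 < m)%N ->
  (forall i, negative_correlation R (D i)) ->
  negative_correlation R (\bigcup_(i in [set: 'I_m]) D i).
Proof.
move=> m0 nD.
(* The induction starts from the empty union, for which any zero-mean correlation works vacuously;
   $m > 0$ provides one. *)
have n0 : negative_correlation R (set0 : set G).
  exact: negative_correlation_sub (nD (Ordinal m0)).
suff H (s : seq 'I_m) : negative_correlation R (\big[setU/set0]_(i <- s) D i).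
  apply: negative_correlation_sub (H (index_enum 'I_m)).
  by move=> g [i _ Dig]; rewrite -bigcup_seq; exists i => //=; rewrite mem_index_enum.
elim: s => [|i s IH]; first by rewrite big_nil.
by rewrite big_cons; exact: negative_correlationU.
Qed.

End negative_correlation.

(** * Passage between complex $L^\infty$ functions and bounded real ones *)

Section complex_functions.
Context (R : realType) d (X : measurableType d) (mu : probability X R).
Implicit Type f : X -> R[i].

Lemma ae_comp_preserving (T : X -> X) (P : set X) : measure_preserving mu T ->
  {ae mu, forall x, P x} -> {ae mu, forall x, P (T x)}.
Proof.
move=> [mT muT] [A [mA A0 PA]]; exists (T @^-1` A); split.
- by rewrite -[X in measurable X]setTI; exact: mT.
- by rewrite -A0; exact: muT.
- by move=> x /= nP; exact: PA.
Qed.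

Lemma ae_eq_Rintegral (f g : X -> R) :
  measurable_fun [set: X] f -> measurable_fun [set: X] g ->
  {ae mu, forall x, f x = g x} -> \int[mu]_x f x = \int[mu]_x g x.
Proof.
move=> mf mg fg; congr fine; apply: ae_eq_integral => //.
- exact/measurable_EFinP.
- exact/measurable_EFinP.
- by apply: filterS fg => x ->.
Qed.

(** Clamping the real and imaginary parts at an essential bound changes [f] only on a null set. *)
Lemma Linfty_ae_bounded f : Linfty mu f ->
  exists u v : X -> R, [/\ bounded_measurable u, bounded_measurable v &
    {ae mu, forall x, f x = Complex (u x) (v x)}].
Proof.
move=> [[mre mim]]; rewrite /finite_norm unlock /=.
(* The norm at exponent $+\infty$ unfolds to a case distinction on whether the whole space has
   positive measure. *)
have -> : (0 < mu [set: X])%E by rewrite (_ : mu setT = 1%E) ?lte01//; exact: probability_setT.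
move=> /ess_supr_bounded[M0 fM0]; pose M := `|M0|.
pose clamp (t : R) := Num.max (- M) (Num.min t M).
have clampM t : `|clamp t| <= M.
  have M1 : 0 <= M by rewrite normr_ge0.
  by rewrite ler_norml /clamp le_max lexx/= ge_max ge_min lexx orbT andbT; lra.
have clampE t : `|t| <= M -> clamp t = t.
  by rewrite ler_norml => /andP[? ?]; rewrite /clamp (min_idPl _)// (max_idPr _).
have bm (g : X -> R) : measurable_fun [set: X] g -> bounded_measurable (fun x => clamp (g x)).
  move=> mg; split; last by exists M.
  by apply: measurable_maxr => //; apply: measurable_minr.
exists (fun x => clamp (complex.Re (f x))), (fun x => clamp (complex.Im (f x))).
split; [exact: bm|exact: bm|].
apply: filterS fM0 => x /=; case: (f x) => a b /=; rewrite ger0_norm ?sqrtr_ge0// => fM.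
have {}fM : Num.sqrt (a ^+ 2 + b ^+ 2) <= M by exact: le_trans fM (ler_norm _).
by congr Complex; rewrite clampE// (le_trans _ fM)// -sqrtr_sqr ler_wsqrtr//
  ?lerDl ?lerDr sqr_ge0.
Qed.

Lemma bounded_measurable_Linfty (h : X -> R) :
  bounded_measurable h -> Linfty mu (fun x => Complex (h x) 0).
Proof.
move=> [mh [M hM]]; split; first by split => //; exact: measurable_cst.
rewrite /finite_norm unlock /=; case: ifPn => // _.
apply: (@le_lt_trans _ _ M%:E); last exact: ltry.
apply: (ess_sup_ler mu (f := fun x => `|Num.sqrt (h x ^+ 2 + 0 ^+ 2)|)) => x.
by rewrite lee_fin expr0n addr0 sqrtr_sqr normr_id.
Qed.

End complex_functions.

(** * Nice vdC sets are exactly the non-negative ones, in the sense of correlations *)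

Section nice_vdC.
Context (R : realType) (G : groupType).
Implicit Types D : set G.

(** Expand $(u \circ T_{g^{-1}} - a)(u - a)$: by invariance both linear terms integrate to $-a^2$,
    and the constant gives back $a^2$. *)
Lemma zero_mean_correlation_center d (X : measurableType d) (mu : probability X R)
    (T : G -> X -> X) (u : X -> R) :
  standard_borel R X -> measure_preserving_action mu T -> bounded_measurable u ->
  zero_mean_correlation
    (fun g => \int[mu]_x (u (T g^-1%g x) * u x) - (\int[mu]_x u x) ^+ 2).
Proof.
move=> sX aT bu; have [_ _ mT] := aT; pose a := \int[mu]_x u x.
have bc c : bounded_measurable (fun _ : X => c : R) := bounded_measurable_cst X c.
exists d, X, mu, T, (fun x => u x + - a); split => //.
- exact: bounded_measurableD.
- by rewrite (probability_RintegralD mu bu (bc (- a))) probability_Rintegral_cst subrr.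
move=> g.
have buT := bounded_measurable_comp (proj1 (mT g^-1%g)) bu.
have bl : bounded_measurable (fun x => - a * (u (T g^-1%g x) + u x)).
  by apply: bounded_measurableM => //; exact: bounded_measurableD.
transitivity (\int[mu]_x (u (T g^-1%g x) * u x + (- a * (u (T g^-1%g x) + u x) + a ^+ 2))).
  by apply: eq_Rintegral => x _; ring.
rewrite (probability_RintegralD mu (bounded_measurableM buT bu)
  (bounded_measurableD bl (bc (a ^+ 2)))).
rewrite (probability_RintegralD mu bl (bc _)) probability_Rintegral_cst.
rewrite (probability_RintegralZ mu _ (bounded_measurableD buT bu)).
rewrite (probability_RintegralD mu buT bu) (Rintegral_comp_preserving (mT _) bu).
by rewrite -/a; ring.
Qed.

(** The function $C + f$ has mean [C] and correlation $C^2 + \varphi$, which on [D] is at most $C^2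
    - e$; the inequality fails with tolerance $e/2$. *)
Lemma negative_correlation_not_nice D :
  negative_correlation R D -> ~ nice_vdC R D.
Proof.
move=> [phi cphi [e e0 phie]] nD; have [M phiM] := zero_mean_correlation_bounded cphi.
have [d [X [mu [T [f [sX aT bf f0 fphi]]]]]] := cphi; have [_ _ mT] := aT.
pose C := `|M| + 1; have C1 : 1 <= C by rewrite lerDr.
have CM : M <= C ^+ 2 by have := ler_norm M; rewrite /C; nra.
have bC : bounded_measurable (fun _ : X => C) := bounded_measurable_cst X C.
have bh := bounded_measurableD bC bf.
pose h x : R[i] := Complex (C + f x) 0.
have Lh : Linfty mu h := bounded_measurable_Linfty mu bh.
have bC2 : bounded_measurable (fun _ : X => C ^+ 2) := bounded_measurable_cst X _.
have [r Dr] := nD _ _ _ _ sX aT h Lh (e / 2) ltac:(lra).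
have -> : cintegral mu h = (C%:C)%C.
  rewrite /cintegral /= probability_Rintegral_cst probability_RintegralD//.
  by rewrite probability_Rintegral_cst f0 addr0.
have bfT := bounded_measurable_comp (proj1 (mT r^-1%g)) bf.
have bfTD := bounded_measurableD bfT bf.
have -> : cintegral mu (fun x => h (T r^-1%g x) * (h x)^*) = ((C ^+ 2 + phi r)%:C)%C.
  rewrite /cintegral /=; congr Complex.
  - transitivity (\int[mu]_x (f (T r^-1%g x) * f x + (C * (f (T r^-1%g x) + f x) + C ^+ 2))).
      by apply: eq_Rintegral => x _; ring.
    rewrite (probability_RintegralD mu (bounded_measurableM bfT bf)
      (bounded_measurableD (bounded_measurableM bC bfTD) bC2)) fphi.
    rewrite (probability_RintegralD mu (bounded_measurableM bC bfTD) bC2).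
    rewrite probability_Rintegral_cst (probability_RintegralZ mu _ bfTD).
    rewrite (probability_RintegralD mu bfT bf) (Rintegral_comp_preserving (mT _) bf) f0.
    by ring.
  - rewrite -[RHS](probability_Rintegral_cst mu); apply: eq_Rintegral => x _ /=; ring.
have pos : 0 <= C ^+ 2 + phi r.
  by have := phiM r; have := ler_norm (- phi r); rewrite normrN; lra.
rewrite !normc_def /= !expr0n /= !addr0 !sqrtr_sqr (ger0_norm pos) ger0_norm; last lra.
have -> : ((C%:C)%C ^+ 2 - ((e / 2)%:C)%C = ((C ^+ 2 - e / 2)%:C)%C :> R[i]).
  by rewrite rmorphB rmorphXn.
rewrite lecR => ?; have := phie r Dr; lra.
Qed.

(** For $f = u + iv$ almost everywhere, the real part of the correlation is the sum of those of [u]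
    and [v], while $|\int f|^2 = a^2 + b^2$. A centred sum above $-e$ at some [g] in [D] would thus
    give the inequality at [g]. *)
Lemma not_nice_negative_correlation D :
  ~ nice_vdC R D -> negative_correlation R D.
Proof.
move=> nnice; apply: contrapT => nneg; apply: nnice => d X mu T sX aT f Lf e e0.
apply: contrapT => nr; apply: nneg.
have [u [v [bu bv fuv]]] := Linfty_ae_bounded Lf; have [_ _ mT] := aT.
have [[mre mim] _] := Lf.
pose a := \int[mu]_x u x; pose b := \int[mu]_x v x.
exists (fun g => (\int[mu]_x (u (T g^-1%g x) * u x) - a ^+ 2)
    + (\int[mu]_x (v (T g^-1%g x) * v x) - b ^+ 2)).
  by apply: zero_mean_correlationD; exact: zero_mean_correlation_center.
exists e => // g Dg; rewrite leNgt; apply/negP => lt; apply: nr; exists g => //.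
have buT := bounded_measurable_comp (proj1 (mT g^-1%g)) bu.
have bvT := bounded_measurable_comp (proj1 (mT g^-1%g)) bv.
have -> : cintegral mu f = Complex a b.
  congr Complex; apply: ae_eq_Rintegral => //; try by [case: bu|case: bv].
  - by apply: filterS fuv => x ->.
  - by apply: filterS fuv => x ->.
(* A lower bound on the real part suffices, so the imaginary part of the correlation is dropped. *)
apply: le_trans (normc_ge_Re _); rewrite /cintegral /=.
have -> : \int[mu]_x complex.Re (f (T g^-1%g x) * (f x)^*) =
    \int[mu]_x (u (T g^-1%g x) * u x + v (T g^-1%g x) * v x).
  apply: ae_eq_Rintegral.
  - have mT' := proj1 (mT g^-1%g).
    have mreT : measurable_fun [set: X] (fun x => complex.Re (f (T g^-1%g x))).
      exact: measurableT_comp mre mT'.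
    have mimT : measurable_fun [set: X] (fun x => complex.Im (f (T g^-1%g x))).
      exact: measurableT_comp mim mT'.
    have := measurable_funD (measurable_funM mreT mre) (measurable_funM mimT mim).
    congr measurable_fun; apply/funext => x /=.
    by case: (f x) => ? ?; case: (f (T _ x)) => ? ? /=; ring.
  - by case: (bounded_measurableD (bounded_measurableM buT bu) (bounded_measurableM bvT bv)).
  (* The identity $f = u + iv$ is needed both at [x] and at its translate; the exceptional set of
     the latter is the preimage of a null set. *)
  - have := ae_comp_preserving (mT g^-1%g) fuv.
    by apply: filterS2 fuv => x -> -> /=; ring.
rewrite (probability_RintegralD mu (bounded_measurableM buT bu) (bounded_measurableM bvT bv)).
have -> : `|(Complex a b : R[i])| ^+ 2 - (e%:C)%C = ((a ^+ 2 + b ^+ 2 - e)%:C)%C.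
  by rewrite normc_def /= -rmorphXn -rmorphB /= sqr_sqrtr// addr_ge0 ?sqr_ge0.
rewrite lecR (le_trans _ (ler_norm _))//; lra.
Qed.

End nice_vdC.

Theorem corollary3p4 (R : realType) (G : groupType)
    (G_countable : countable [set: G]) (G_infinite : infinite_set [set: G])
    (D : set G) (D_nice : nice_vdC R D)
    (m : nat) (m_gt0 : (1 <= m)%N) (Di : 'I_m -> set G)
    (D_union : D = \bigcup_(i in [set: 'I_m]) Di i) :
  exists i : 'I_m, nice_vdC R (Di i).
Proof.
(* If no piece were nice, all pieces would be negative, and so would their union [D]. *)
apply: contrapT => nDi; apply: (@negative_correlation_not_nice R G D) => //.
rewrite D_union; apply: negative_correlation_bigcup => // i.
by apply: not_nice_negative_correlation => nD; apply: nDi; exists i.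
Qed.
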